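(* There exists a two-dimensional complex Banach space $F$ such that the completed projective tensor product $L_\infty^{\mathbb{C}}[0,1]\widehat{\otimes}_{\pi}F$ fails the Daugavet property, where $L_\infty^{\mathbb{C}}[0,1]$ denotes the space of complex-valued $L_\infty$-functions on $[0,1]$ (with Lebesgue measure).
   Context: A (complex) Banach space $W$ has the Daugavet property if $\|\mathrm{Id}+T\|=1+\|T\|$ for every bounded ($\mathbb{C}$-linear) rank-1 operator $T\colon W\to W$. $\widehat{\otimes}_{\pi}$ denotes the completed projective tensor product of complex Banach spaces. *)

(* Defs.v *)
From HB Require Import structures.
From mathcomp Require Import all_boot all_order all_algebra.
From mathcomp Require Import sesquilinear complex.
From mathcomp Require Import all_classical all_reals all_analysis.
From mathcomp Require Import measurable_realfun ess_sup_inf.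
Set Implicit Arguments.
Unset Strict Implicit.
Unset Printing Implicit Defensive.
Import Order.TTheory GRing.Theory Num.Theory.
Import numFieldNormedType.Exports.
Import ComplexField.Normc.
Local Open Scope classical_set_scope.
Local Open Scope ring_scope.
Local Open Scope complex_scope.

(* Complex Banach spaces are [completeNormedModType R[i]].  Their norm takes
   its values in the scalar field R[i]; these values are real and [rnorm]
   reads them in R. *)
Definition rnorm (R : realType) (W : normedModType R[i]) (w : W) : R :=
  complex.Re `|w|.

Section Daugavet.
Context (R : realType).

Definition bounded_operator (V W : normedModType R[i]) (T : V -> W) : Prop :=
  exists M : R, forall x, rnorm (T x) <= M * rnorm x.

Definition opnorm (V W : normedModType R[i]) (T : V -> W) : R :=
  sup [set rnorm (T x) | x in [set x : V | rnorm x <= 1]].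

Definition rank1 (V W : lmodType R[i]) (T : V -> W) : Prop :=
  exists2 y : W, y != 0 & range T = [set a *: y | a in [set: R[i]]].

Definition Daugavet (W : completeNormedModType R[i]) : Prop :=
  forall T : {linear W -> W}, bounded_operator T -> rank1 T ->
    opnorm (fun x => x + T x) = 1 + opnorm T.

End Daugavet.

Section ProjectiveTensorProduct.
Context (R : realType).

(* The algebraic tensor product, by its universal property. *)
Definition algebraic_tensor (X Y E : lmodType R[i])
    (t : {bilinear X -> Y -> E}) : Prop :=
  forall (V : lmodType R[i]) (f : {bilinear X -> Y -> V}),
    exists! g : {linear E -> V}, forall x y, g (t x y) = f x y.

Definition pi_norm (X Y : normedModType R[i]) (E : lmodType R[i])
    (t : {bilinear X -> Y -> E}) (u : E) : R :=
  inf [set \sum_(p <- s) rnorm p.1 * rnorm p.2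
      | s in [set s : seq (X * Y) | u = \sum_(p <- s) t p.1 p.2]].

(* Z is the completion of the algebraic tensor product for the projective
   norm: the latter sits isometrically and densely in the Banach space Z.
   This determines Z up to isometric isomorphism. *)
Definition is_projective_tensor (X Y : normedModType R[i])
    (Z : completeNormedModType R[i]) : Prop :=
  exists (E : lmodType R[i]) (t : {bilinear X -> Y -> E})
         (j : {linear E -> Z}),
    [/\ algebraic_tensor t,
        forall u, rnorm (j u) = pi_norm t u
      & dense (range j)].

End ProjectiveTensorProduct.

Section Linfty.
Context d (T : measurableType d) (R : realType).
Variable mu : {measure set T -> \bar R}.

(* Measurable, essentially bounded functions T -> R[i]; the library provides
   no measurable structure on R[i], so measurability is that of the real and
   imaginary parts. *)
Definition cLinf_fun : {pred T -> R[i]} := mem [set f : T -> R[i] |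
  [/\ measurable_fun [set: T] (fun x => complex.Re (f x)),
      measurable_fun [set: T] (fun x => complex.Im (f x))
    & finite_norm mu +oo%E (fun x => normc (f x))]].

Lemma finite_norm_ooP (g : T -> R) : (forall x, 0 <= g x) ->
  finite_norm mu +oo%E g <-> exists M : R, \forall x \ae mu, g x <= M.
Proof.
move=> g0; rewrite /finite_norm unlock; case: ifPn => mu0; last first.
  split=> // _; exists 0.
  have T0 : mu setT = 0%E.
    by apply/eqP; rewrite eq_le measure_ge0 andbT leNgt.
  by exists setT; split.
split=> [h|[M hM]].
  exists (fine (ess_sup mu (abse \o (EFin \o g)))).
  have := ess_sup_ge mu (abse \o (EFin \o g)); apply: filterS => x /= hx.
  rewrite -lee_fin fineK; last first.
    rewrite fin_numElt h andbT (lt_le_trans _ (_ : 0 <= _)%E)//.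
    by apply: ess_sup_gee => //; apply: nearW => y; exact: abse_ge0.
  by rewrite (le_trans _ hx)// lee_fin ler_norm.
apply: (@le_lt_trans _ _ M%:E); last exact: ltry.
apply/ess_supP; apply: filterS hM => x /= hx.
by rewrite lee_fin ger0_norm.
Qed.

Lemma normc_ge0 (z : R[i]) : 0 <= normc z.
Proof. by case: z => a b; exact: sqrtr_ge0. Qed.

Lemma cLinf_funP (f : T -> R[i]) : f \in cLinf_fun <->
  [/\ measurable_fun [set: T] (fun x => complex.Re (f x)),
      measurable_fun [set: T] (fun x => complex.Im (f x))
    & exists M : R, \forall x \ae mu, normc (f x) <= M].
Proof.
rewrite inE /=; split=> -[mr mi h]; split=> //.
- by apply/finite_norm_ooP => // x; exact: normc_ge0.
- by apply/finite_norm_ooP => // x; exact: normc_ge0.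
Qed.

Lemma cLinf_submod_closed : submod_closed cLinf_fun.
Proof.
split.
  apply/cLinf_funP; split; try exact: measurable_cst.
  by exists 0; apply: nearW => x; rewrite normc0.
move=> a f g /cLinf_funP[fr fi [M fM]] /cLinf_funP[gr gi [N gN]].
have E x : (a *: f + g) x = a * f x + g x by [].
apply/cLinf_funP; split.
- rewrite [X in measurable_fun _ X](_ : _ = (fun x =>
    complex.Re a * complex.Re (f x)
    - complex.Im a * complex.Im (f x) + complex.Re (g x))); last first.
    by apply/funext => x; rewrite E; case: (a) (f x) (g x) => ? ? [? ?] [].
  apply: measurable_funD => //; apply: measurable_funB;
    by apply: measurable_funM => //; exact: measurable_cst.
- rewrite [X in measurable_fun _ X](_ : _ = (fun x =>
    complex.Re a * complex.Im (f x)
    + complex.Im a * complex.Re (f x) + complex.Im (g x))); last first.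
    by apply/funext => x; rewrite E; case: (a) (f x) (g x) => ? ? [? ?] [].
  apply: measurable_funD => //; apply: measurable_funD;
    by apply: measurable_funM => //; exact: measurable_cst.
- exists (normc a * M + N).
  apply: filterS2 fM gN => x hf hg.
  rewrite E (le_trans (le_normcD _ _))// lerD//.
  by rewrite normcM ler_wpM2l// normc_ge0.
Qed.

HB.instance Definition _ :=
  GRing.isSubmodClosed.Build _ _ cLinf_fun cLinf_submod_closed.

Record cLinf := CLinf { cLinf_val :> T -> R[i]; _ : cLinf_val \in cLinf_fun }.
HB.instance Definition _ := [isSub for cLinf_val].
HB.instance Definition _ := [Choice of cLinf by <:].
HB.instance Definition _ := [SubChoice_isSubLmodule of cLinf by <:].

Definition cLinf_norm (f : cLinf) : R :=
  fine (Lnorm mu +oo (fun x => (normc (f x))%:E)).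

Lemma cLinf_norm_ge0 f : 0 <= cLinf_norm f.
Proof. by apply: fine_ge0; exact: Lnorm_ge0. Qed.

Lemma cLinf_normP (f : cLinf) (M : R) : 0 <= M ->
  cLinf_norm f <= M <-> \forall x \ae mu, normc (f x) <= M.
Proof.
move=> M0; have := valP f; rewrite inE => -[_ _ fin].
rewrite -lee_fin /cLinf_norm fineK; last first.
  rewrite fin_numElt; apply/andP; split=> //.
  by apply: lt_le_trans (Lnorm_ge0 _ _ _).
rewrite unlock; case: ifPn => mu0; last first.
  split=> // _.
  have T0 : mu setT = 0%E.
    by apply/eqP; rewrite eq_le measure_ge0 andbT leNgt.
  by exists setT; split.
split=> [/ess_supP|h].
  by apply: filterS => x /=; rewrite lee_fin ger0_norm// normc_ge0.
apply/ess_supP; apply: filterS h => x /=.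
by rewrite lee_fin ger0_norm// normc_ge0.
Qed.

Lemma cLinf_norm_ae (f : cLinf) : \forall x \ae mu, normc (f x) <= cLinf_norm f.
Proof. by apply/cLinf_normP => //; exact: cLinf_norm_ge0. Qed.

Definition cLinf_eq (f g : cLinf) := `[< \forall x \ae mu, f x = g x >].

Lemma cLinf_eq_refl : reflexive cLinf_eq.
Proof. by move=> f; apply/asboolP; apply: nearW. Qed.

Lemma cLinf_eq_sym : symmetric cLinf_eq.
Proof.
by move=> f g; apply/idP/idP => /asboolP h; apply/asboolP; apply: filterS h.
Qed.

Lemma cLinf_eq_trans : transitive cLinf_eq.
Proof.
move=> f g h /asboolP gf /asboolP fh; apply/asboolP.
by apply: filterS2 gf fh => x -> ->.
Qed.

Canonical cLinf_eq_canonical :=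
  EquivRel cLinf_eq cLinf_eq_refl cLinf_eq_sym cLinf_eq_trans.

Local Open Scope quotient_scope.

Definition cLinfty : Type := {eq_quot cLinf_eq}.
HB.instance Definition _ := Choice.on cLinfty.
HB.instance Definition _ := EqQuotient.on cLinfty.

Lemma cLinfty_eqP (f g : cLinf) :
  reflect (\forall x \ae mu, f x = g x) (\pi_cLinfty f == \pi_cLinfty g).
Proof. by apply: (iffP idP); rewrite eqmodE => /asboolP. Qed.

Lemma cLinfty_reprP (f : cLinf) :
  \forall x \ae mu, repr (\pi_cLinfty f) x = f x.
Proof. by apply/cLinfty_eqP; rewrite reprK. Qed.

Lemma cLinfty_piP (u : cLinfty) : exists f, u = \pi_cLinfty f.
Proof. by exists (repr u); rewrite reprK. Qed.

Definition cLinfty_zero : cLinfty := \pi_cLinfty 0.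
Definition cLinfty_opp (u : cLinfty) : cLinfty := \pi_cLinfty (- repr u).
Definition cLinfty_add (u v : cLinfty) : cLinfty :=
  \pi_cLinfty (repr u + repr v).
Definition cLinfty_scale (a : R[i]) (u : cLinfty) : cLinfty :=
  \pi_cLinfty (a *: repr u).

Lemma cLinfty_piN f : cLinfty_opp (\pi_cLinfty f) = \pi_cLinfty (- f).
Proof.
by apply/eqP/cLinfty_eqP; apply: filterS (cLinfty_reprP f) => x fx;
  exact: (congr1 -%R fx).
Qed.

Lemma cLinfty_piD f g : cLinfty_add (\pi_cLinfty f) (\pi_cLinfty g) =
  \pi_cLinfty (f + g).
Proof.
apply/eqP/cLinfty_eqP.
by apply: filterS2 (cLinfty_reprP f) (cLinfty_reprP g) => x fx gx;
  exact: (congr2 +%R fx gx).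
Qed.

Lemma cLinfty_piZ a f : cLinfty_scale a (\pi_cLinfty f) = \pi_cLinfty (a *: f).
Proof.
by apply/eqP/cLinfty_eqP; apply: filterS (cLinfty_reprP f) => x fx;
  exact: (congr1 ( *%R a) fx).
Qed.

Lemma cLinfty_addA : associative cLinfty_add.
Proof.
move=> u v w; have [f ->] := cLinfty_piP u.
have [g ->] := cLinfty_piP v; have [h ->] := cLinfty_piP w.
by rewrite !cLinfty_piD addrA.
Qed.

Lemma cLinfty_addC : commutative cLinfty_add.
Proof.
move=> u v; have [f ->] := cLinfty_piP u; have [g ->] := cLinfty_piP v.
by rewrite !cLinfty_piD addrC.
Qed.

Lemma cLinfty_add0 : left_id cLinfty_zero cLinfty_add.
Proof.
by move=> u; have [f ->] := cLinfty_piP u; rewrite cLinfty_piD add0r.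
Qed.

Lemma cLinfty_addN : left_inverse cLinfty_zero cLinfty_opp cLinfty_add.
Proof.
by move=> u; have [f ->] := cLinfty_piP u; rewrite cLinfty_piN cLinfty_piD addNr.
Qed.

HB.instance Definition _ := GRing.isZmodule.Build cLinfty
  cLinfty_addA cLinfty_addC cLinfty_add0 cLinfty_addN.

Lemma cLinfty_scaleA a b u :
  cLinfty_scale a (cLinfty_scale b u) = cLinfty_scale (a * b) u.
Proof. by have [f ->] := cLinfty_piP u; rewrite !cLinfty_piZ scalerA. Qed.

Lemma cLinfty_scale1 : left_id 1 cLinfty_scale.
Proof.
by move=> u; have [f ->] := cLinfty_piP u; rewrite cLinfty_piZ scale1r.
Qed.

Lemma cLinfty_scaleDr : right_distributive cLinfty_scale +%R.
Proof.
move=> a u v; have [f ->] := cLinfty_piP u; have [g ->] := cLinfty_piP v.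
by rewrite /GRing.add/= !(cLinfty_piZ, cLinfty_piD) scalerDr.
Qed.

Lemma cLinfty_scaleDl u : {morph cLinfty_scale^~ u : a b / a + b}.
Proof.
move=> a b; have [f ->] := cLinfty_piP u.
by rewrite [RHS]/GRing.add/= !(cLinfty_piZ, cLinfty_piD) scalerDl.
Qed.

HB.instance Definition _ := GRing.Zmodule_isLmodule.Build R[i] cLinfty
  cLinfty_scaleA cLinfty_scale1 cLinfty_scaleDr cLinfty_scaleDl.

Definition cLinfty_norm (u : cLinfty) : R[i] := (cLinf_norm (repr u))%:C.

Lemma cLinfty_norm_pi f : cLinfty_norm (\pi_cLinfty f) = (cLinf_norm f)%:C.
Proof.
congr (_%:C); apply/eqP; rewrite eq_le; apply/andP; split.
- apply/cLinf_normP; first exact: cLinf_norm_ge0.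
  by apply: filterS2 (cLinfty_reprP f) (cLinf_norm_ae f) => x ->.
- apply/cLinf_normP; first exact: cLinf_norm_ge0.
  by apply: filterS2 (cLinfty_reprP f)
    (cLinf_norm_ae (repr (\pi_cLinfty f))) => x ->.
Qed.

Lemma cLinfty_normD u v :
  cLinfty_norm (u + v) <= cLinfty_norm u + cLinfty_norm v.
Proof.
have [f ->] := cLinfty_piP u; have [g ->] := cLinfty_piP v.
rewrite [_ + _ as X in cLinfty_norm X]cLinfty_piD.
rewrite !cLinfty_norm_pi -rmorphD lecR.
apply/cLinf_normP; first by rewrite addr_ge0 ?cLinf_norm_ge0.
apply: filterS2 (cLinf_norm_ae f) (cLinf_norm_ae g) => x hf hg.
by rewrite (le_trans (le_normcD _ _))// lerD.
Qed.

Lemma cLinf_normZ_le a f : cLinf_norm (a *: f) <= normc a * cLinf_norm f.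
Proof.
apply/cLinf_normP; first by rewrite mulr_ge0 ?normc_ge0 ?cLinf_norm_ge0.
apply: filterS (cLinf_norm_ae f) => x hf.
by rewrite [X in normc X]/(a * f x) normcM ler_wpM2l ?normc_ge0.
Qed.

Lemma cLinfty_normZ a u : cLinfty_norm (a *: u) = `|a| * cLinfty_norm u.
Proof.
have [f ->] := cLinfty_piP u; rewrite [_ *: _]cLinfty_piZ !cLinfty_norm_pi.
rewrite [`|a|](_ : _ = (normc a)%:C)// -rmorphM; congr (_%:C).
apply/eqP; rewrite eq_le cLinf_normZ_le/=.
have [->|a0] := eqVneq a 0; first by rewrite normc0 mul0r cLinf_norm_ge0.
have na0 : 0 < normc a.
  by rewrite lt_def normc_ge0 andbT; apply: contra_neq a0 => /eq0_normc.
rewrite -ler_pdivlMl// -normcV -[X in cLinf_norm X <= _](@scale1r R[i]).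
by rewrite -(mulVf a0) -scalerA cLinf_normZ_le.
Qed.

Lemma cLinfty_norm0_eq0 u : cLinfty_norm u = 0 -> u = 0.
Proof.
have [f ->] := cLinfty_piP u; rewrite cLinfty_norm_pi => -[f0].
apply/eqP/cLinfty_eqP; apply: filterS (cLinf_norm_ae f) => x.
by rewrite f0 => fx; apply: eq0_normc; apply/eqP; rewrite eq_le fx normc_ge0.
Qed.

HB.instance Definition _ := Lmodule_isNormed.Build R[i] cLinfty
  cLinfty_normD cLinfty_normZ cLinfty_norm0_eq0.

End Linfty.

(* Lebesgue measure on [0,1] is Lebesgue measure on the line restricted to
   [0,1], so the functions below are defined on the line but identified when
   they agree almost everywhere on [0,1]. *)
Definition lebesgue01 (R : realType) :
    {measure set (measurableTypeR R) -> \bar R} :=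
  mrestr (@lebesgue_measure R) (measurable_itv `[0%R, 1%R]).

Definition Linfty01 (R : realType) : normedModType R[i] :=
  cLinfty (lebesgue01 R).

(* Main.v *)
Require Import Defs.
From HB Require Import structures.
From mathcomp Require Import all_boot all_order all_algebra.
From mathcomp Require Import complex.
From mathcomp Require Import all_classical all_reals all_analysis.
From mathcomp Require Import sesquilinear measurable_realfun ring lra.

(** Let [F] be [C^2] normed by [max(|a|, |b| + |a|/2)].  The algebraic tensor
    product of [Linfty] and [F] is [Linfty * Linfty], complete for the projective
    norm.  Let [T (u, v) = ((int v) 1, 0)]: it has rank one and norm at least one,
    since [T (0, 1) = (1, 0)].  The projective norm is generated by elementary
    tensors, so [|Id + T| < 2] reduces to a bound on [(c, g)], with [c = int g] and
    [|g| <= 1], strictly below [2]; rotating [g] one may take [c >= 0].  Now spread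
    [c] over the four vectors [(1, +-1/2), (1, +-i/2)] of norm one, with purely
    imaginary perturbations of size [delta] of the coefficient [c/4] chosen to
    produce the second coordinate [(delta/4) g].  They cost [O(delta^2)] and save
    [delta/4]; this is where complex scalars matter. *)

Set Implicit Arguments.
Unset Strict Implicit.
Unset Printing Implicit Defensive.
Import Order.TTheory GRing.Theory Num.Theory.
Import numFieldNormedType.Exports.
Import ComplexField.Normc.
Local Open Scope classical_set_scope.
Local Open Scope ring_scope.
Local Open Scope complex_scope.

(** * The modulus of a complex number *)

Section ComplexModulus.
Context (R : realType).

Lemma normc_ReIm (z : R[i]) : normc z <= `|complex.Re z| + `|complex.Im z|.
Proof.
case: z => a b; rewrite /= -[leRHS]ger0_norm ?addr_ge0// -sqrtr_sqr.
rewrite ler_sqrt ?sqr_ge0// sqrrD !real_normK ?num_real//.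
by rewrite lerD2r lerDl mulrn_wge0// mulr_ge0.
Qed.

Lemma normc_Re (z : R[i]) : `|complex.Re z| <= normc z.
Proof.
by case: z => a b; rewrite /= -sqrtr_sqr ler_sqrt ?lerDl ?addr_ge0 ?sqr_ge0.
Qed.

Lemma normc_Im (z : R[i]) : `|complex.Im z| <= normc z.
Proof.
by case: z => a b; rewrite /= -sqrtr_sqr ler_sqrt ?lerDr ?addr_ge0 ?sqr_ge0.
Qed.

Lemma normc_real (r : R) : 0 <= r -> normc r%:C = r.
Proof. by move=> r0; rewrite /= expr0n addr0 sqrtr_sqr ger0_norm. Qed.

(** Dividing by the modulus gives the unit factor, and [z = 0] gets the factor [1]. This is the
    rotation used below to make a mean real and nonnegative. *)
Lemma complex_polar (z : R[i]) : exists2 e, normc e = 1 & z = (normc z)%:C * e.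
Proof.
have [->|z0] := eqVneq z 0.
  by exists 1; [exact: (normc_real ler01)|rewrite normc0 mul0r].
have nz0 : normc z != 0 by apply: contra_neq z0 => /eq0_normc.
have n0 : (normc z)%:C != 0 :> R[i] by rewrite fmorph_eq0.
exists ((normc z)%:C^-1 * z); last by rewrite mulrA divff// mul1r.
by rewrite normcM normcV normc_real ?normc_ge0// mulVf.
Qed.

End ComplexModulus.

(** Bundled linear maps carry proofs, so proof irrelevance is what makes pointwise equality an
    equality of records. The uniqueness clause of the universal property requires the latter. *)
Lemma linear_ext (K : pzRingType) (U V : lmodType K) (f g : {linear U -> V}) :
  f =1 g -> f = g.
Proof.
case: f g => f [[[f0 fD]] [fZ]] [g [[[g0 gD]] [gZ]]] /funext /= fg; subst g.
rewrite (Prop_irrelevance f0 g0) (Prop_irrelevance fD gD).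
by rewrite (Prop_irrelevance fZ gZ).
Qed.

(** * Real-valued norms *)

Section Rnorm.
Context (R : realType) (W : normedModType R[i]).
Implicit Types w : W.

(** Nonnegativity in [R[i]] forces the imaginary part to vanish. *)
Lemma rnormE w : `|w| = (rnorm w)%:C.
Proof.
by have := normr_ge0 w; rewrite /rnorm; case: `|w| => a b;
  rewrite lecE /= => /andP[/eqP->].
Qed.

Lemma rnorm_ge0 w : 0 <= rnorm w.
Proof. by rewrite -lecR -rnormE; exact: normr_ge0. Qed.

Lemma rnormD w1 w2 : rnorm (w1 + w2) <= rnorm w1 + rnorm w2.
Proof. by rewrite -lecR rmorphD /= -!rnormE ler_normD. Qed.

Lemma rnormZ (a : R[i]) w : rnorm (a *: w) = normc a * rnorm w.
Proof.
by apply: (fmorph_inj (real_complex R)); rewrite rmorphM /= -!rnormE normrZ.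
Qed.

Lemma rnorm0 : rnorm (0 : W) = 0.
Proof. by rewrite /rnorm normr0. Qed.

Lemma rnorm0_eq0 w : rnorm w = 0 -> w = 0.
Proof. by move=> w0; apply/normr0_eq0; rewrite rnormE w0. Qed.

Lemma rdistC w1 w2 : rnorm (w1 - w2) = rnorm (w2 - w1).
Proof. by rewrite /rnorm distrC. Qed.

End Rnorm.

(** * The projective norm *)

Section ProjectiveNorm.
Context (R : realType) (X Y : normedModType R[i]) (E : lmodType R[i]).
Variable t : {bilinear X -> Y -> E}.
Hypothesis span : forall u, exists s : seq (X * Y), u = \sum_(p <- s) t p.1 p.2.

Let cost (s : seq (X * Y)) := \sum_(p <- s) rnorm p.1 * rnorm p.2.

Let cost_ge0 s : 0 <= cost s.
Proof. by apply: sumr_ge0 => p _; rewrite mulr_ge0 ?rnorm_ge0. Qed.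

Lemma pi_norm_le_sum s u : u = \sum_(p <- s) t p.1 p.2 ->
  pi_norm t u <= \sum_(p <- s) rnorm p.1 * rnorm p.2.
Proof.
move=> us; apply: ge_inf; last by exists s.
by exists 0 => _ [r _ <-]; exact: cost_ge0.
Qed.

Lemma pi_norm_tensor x y : pi_norm t (t x y) <= rnorm x * rnorm y.
Proof.
have := @pi_norm_le_sum [:: (x, y)] (t x y).
by rewrite !big_seq1; exact.
Qed.

(** By [span] the set of costs is nonempty, so its [inf] is a true greatest lower bound and not a
    default value. *)
Lemma pi_norm_lb u (a : R) :
  (forall s, u = \sum_(p <- s) t p.1 p.2 ->
     a <= \sum_(p <- s) rnorm p.1 * rnorm p.2) -> a <= pi_norm t u.
Proof.
move=> h; apply: lb_le_inf.
  by have [s us] := span u; exists (cost s), s.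
by move=> _ [s us <-]; exact: h.
Qed.

Lemma pi_norm_ge0 u : 0 <= pi_norm t u.
Proof. by apply: pi_norm_lb => s _; exact: cost_ge0. Qed.

(** Concatenating representations of [u] and [v] represents [u + v]; the two infima are then taken
    one after the other. *)
Lemma pi_normD u v : pi_norm t (u + v) <= pi_norm t u + pi_norm t v.
Proof.
rewrite -lerBlDr; apply: pi_norm_lb => s us; rewrite lerBlDr -lerBlDl.
apply: pi_norm_lb => r vr; rewrite lerBlDl -big_cat.
by apply: pi_norm_le_sum; rewrite big_cat -us -vr.
Qed.

(** Subadditivity carries a bound from elementary tensors to every representation, hence to the
    infimum. The coordinate projections and the identity plus [mean_op] are estimated this way. *)
Lemma le_pi_norm (N : E -> R) (K : R) : 0 <= K -> N 0 <= 0 ->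
  (forall u v, N (u + v) <= N u + N v) ->
  (forall x y, N (t x y) <= K * (rnorm x * rnorm y)) ->
  forall u, N u <= K * pi_norm t u.
Proof.
move=> K0 N0 ND Nt u.
have Nsum s : N (\sum_(p <- s) t p.1 p.2) <= K * cost s.
  rewrite /cost; elim: s => [|p s IH]; first by rewrite !big_nil mulr0.
  by rewrite !big_cons mulrDr (le_trans (ND _ _))// lerD.
(* Dividing by [K] needs [K > 0]; when [K = 0], a single representation already gives [N u <= 0]. *)
have [K_eq0|Kn0] := eqVneq K 0.
  by have [s ->] := span u; have := Nsum s; rewrite K_eq0 !mul0r.
have Kp : 0 < K by rewrite lt_def Kn0.
rewrite -ler_pdivrMl//; apply: pi_norm_lb => s ->.
by rewrite ler_pdivrMl.
Qed.

Lemma pi_norm0 : pi_norm t 0 = 0.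
Proof.
apply/eqP; rewrite eq_le pi_norm_ge0 andbT.
by have := @pi_norm_le_sum [::] 0; rewrite !big_nil; exact.
Qed.

(** One inequality comes from [le_pi_norm]; applying it to the inverse scalar gives the other. *)
Lemma pi_normZ (a : R[i]) u : pi_norm t (a *: u) = normc a * pi_norm t u.
Proof.
have le b v : pi_norm t (b *: v) <= normc b * pi_norm t v.
  apply: (le_pi_norm (N := fun v => pi_norm t (b *: v))).
  - exact: normc_ge0.
  - by rewrite scaler0 pi_norm0.
  - by move=> v1 v2; rewrite scalerDr pi_normD.
  - move=> x y; rewrite mulrA -rnormZ -linearZl_LR.
    exact: pi_norm_tensor.
have [->|a0] := eqVneq a 0; first by rewrite scale0r pi_norm0 normc0 mul0r.
have na0 : 0 < normc a.
  by rewrite lt_def normc_ge0 andbT; apply: contra_neq a0 => /eq0_normc.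
apply/eqP; rewrite eq_le le/= -ler_pdivlMl// -normcV.
by rewrite -[X in pi_norm t X <= _]scale1r -(mulVf a0) -scalerA le.
Qed.

End ProjectiveNorm.

(** * Completeness *)

Section RapidCompleteness.
Context (R : realType).

(** Completeness tested on geometrically fast sequences. [N] is an arbitrary function, so this also
    covers the seminorm on functions before identification almost everywhere; the free constant [C]
    survives a change to an equivalent norm. *)
Definition rapid_complete (V : zmodType) (N : V -> R) : Prop :=
  forall u : nat -> V,
    (forall n m, (n <= m)%N -> N (u n - u m) <= 2^-1 ^+ n) ->
    exists l C, forall n, N (u n - l) <= C * 2^-1 ^+ n.

Lemma half_expn_gt0 n : 0 < 2^-1 ^+ n :> R.
Proof. by rewrite exprn_gt0// invr_gt0 ltr0n. Qed.

Lemma half_expn_lt (e : R) : 0 < e -> exists n, 2^-1 ^+ n < e.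
Proof.
move=> e0; have h : `|2^-1 : R| < 1.
  by rewrite ger0_norm ?invr_ge0// invf_lt1// ltr1n.
have /cvgr0_norm_lt/(_ e e0)[n _ hn] := cvg_expr h.
exists n; have := hn n (leqnn n); rewrite /= ger0_norm//.
Qed.

Lemma half_expn_cvg0 (C a : R) : (forall n, a <= C * 2^-1 ^+ n) -> a <= 0.
Proof.
move=> h; rewrite leNgt; apply/negP => a0.
have C0 : 0 < C.
  rewrite ltNge; apply/negP => C0; have := h 0; rewrite expr0 mulr1 => aC.
  by have := lt_le_trans a0 (le_trans aC C0); rewrite ltxx.
have [n hn] := half_expn_lt (divr_gt0 a0 C0).
by have := h n; rewrite leNgt mulrC -ltr_pdivlMr ?hn.
Qed.

(** The intervals of centre [u n] and radius [2^-n] meet pairwise, so the supremum of their left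
    endpoints lies in all of them. *)
Lemma rapid_complete_real : rapid_complete (Num.norm : R -> R).
Proof.
move=> u hu; have uu n m : u n - 2^-1 ^+ n <= u m + 2^-1 ^+ m.
  have p k := ltW (half_expn_gt0 k).
  have [/hu|/ltnW/hu] := leqP n m; rewrite ler_norml => /andP[a b];
    by have := p n; have := p m; lra.
pose A := range (fun n => u n - 2^-1 ^+ n).
exists (sup A), 1 => n; rewrite mul1r ler_norml; apply/andP; split.
  have : sup A <= u n + 2^-1 ^+ n.
    by apply: ge_sup; [exists (u 0 - 2^-1 ^+ 0), 0|move=> _ [m _ <-]].
  lra.
have : u n - 2^-1 ^+ n <= sup A.
  apply: ub_le_sup; last by exists n.
  by exists (u 0 + 2^-1 ^+ 0) => _ [m _ <-].
lra.
Qed.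

(** Limits are taken by coordinates, [N] being comparable with [N1 + N2]. This serves [R[i]], the
    plane and the tensor product alike. *)
Lemma rapid_complete_prod (V1 V2 V : zmodType) (N1 : V1 -> R) (N2 : V2 -> R)
    (N : V -> R) (p1 : V -> V1) (p2 : V -> V2) (pair : V1 -> V2 -> V) (K : R) :
  {morph p1 : u v / u - v} -> {morph p2 : u v / u - v} ->
  (forall a b, p1 (pair a b) = a) -> (forall a b, p2 (pair a b) = b) ->
  0 <= K ->
  (forall v, N1 (p1 v) <= N v) -> (forall v, N2 (p2 v) <= N v) ->
  (forall v, N v <= K * (N1 (p1 v) + N2 (p2 v))) ->
  rapid_complete N1 -> rapid_complete N2 -> rapid_complete N.
Proof.
move=> p1B p2B pair1 pair2 K0 N1le N2le Nle c1 c2 u hu.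
have [|l1 [C1 h1]] := c1 (p1 \o u).
  by move=> n m nm; rewrite /= -p1B (le_trans (N1le _))// hu.
have [|l2 [C2 h2]] := c2 (p2 \o u).
  by move=> n m nm; rewrite /= -p2B (le_trans (N2le _))// hu.
exists (pair l1 l2), (K * (C1 + C2)) => n.
rewrite (le_trans (Nle _))// -mulrA ler_wpM2l// mulrDl.
by rewrite p1B p2B pair1 pair2 lerD// ?h1 ?h2.
Qed.

Lemma rapid_complete_complex : rapid_complete (@normc R).
Proof.
apply: (@rapid_complete_prod _ _ _ Num.norm Num.norm (@normc R)
  (@complex.Re R) (@complex.Im R) (@Complex R) 1) => //.
- exact: raddfB.
- exact: raddfB.
- exact: normc_Re.
- exact: normc_Im.
- by move=> z; rewrite mul1r normc_ReIm.
- exact: rapid_complete_real.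
- exact: rapid_complete_real.
Qed.


(** A Cauchy filter contains a ball of radius [2^-(n+1)] for each [n]. Any two of these balls meet,
    so their centres form a fast sequence, whose limit is that of the filter. *)
Lemma rapid_complete_cvg (W : normedModType R[i]) :
  rapid_complete (@rnorm R W) ->
  forall F : set_system W, ProperFilter F -> cauchy F -> cvg F.
Proof.
move=> cW F FF /cauchyP cF.
have hx n : exists x : W, F (ball x (2^-1 ^+ n.+1)%:C).
  by apply: cF; rewrite ltcR half_expn_gt0.
have [x Fx] := choice hx.
have ballx (y z : W) (e : R) : ball y e%:C z <-> rnorm (y - z) < e.
  by rewrite -ball_normE /= rnormE ltcR.
have [|l [C hl]] := cW x.
  move=> n m nm; have [z [/ballx xz /ballx yz]] := filter_ex (filterI (Fx n) (Fx m)).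
  rewrite -(subrKA z) (le_trans (rnormD _ _))// [in leLHS](rdistC z).
  have : 2^-1 ^+ m.+1 <= 2^-1 ^+ n.+1 :> R.
    by rewrite ler_wiXn2l ?invf_le1 ?invr_ge0 ?ler1n.
  by rewrite (exprS _ n); move: xz yz; rewrite (exprS _ n); lra.
apply/cvg_ex; exists l; apply/cvgrPdist_lt => e e0.
have [r0 ->] : 0 < complex.Re e /\ e = (complex.Re e)%:C.
  by move: e e0 => [a b]; rewrite ltcE /= => /andP[/eqP -> ?].
(* [C] may be negative, hence the absolute value; the added [1] absorbs the radius [2^-(n+1)]. *)
have C1 : 0 < `|C| + 1 by rewrite ltr_wpDl.
have [n hn] := half_expn_lt (divr_gt0 r0 C1).
apply: filterS (Fx n) => z /ballx xz.
rewrite rnormE ltcR -(subrKA (x n)) (le_lt_trans (rnormD _ _))// [in ltLHS]rdistC.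
have := hl n; have := half_expn_gt0 n; have := ler_norm C.
by move: hn xz; rewrite ltr_pdivlMr// exprS; nra.
Qed.

End RapidCompleteness.

(** * Completeness of [cLinfty] *)

Section LinftyComplete.
Context d (T : measurableType d) (R : realType).
Variable mu : {measure set T -> \bar R}.

(** Off one null set all the countably many estimates hold pointwise, so the sequence converges
    there at a uniform rate to a measurable function. *)
Lemma cLinf_rapid_complete : rapid_complete (@cLinf_norm d T R mu).
Proof.
move=> f hf.
(* Keeping [n <= m] inside the almost-everywhere statement lets [ae_foralln] quantify over all
   pairs. *)
have aef n m : \forall x \ae mu, (n <= m)%N ->
    normc (f n x - f m x) <= 2^-1 ^+ n.
  have [nm|mn] := leqP n m; last exact: aeW.
  have /cLinf_normP := hf n m nm.
  by move=> /(_ (ltW (half_expn_gt0 _ _))); apply: filterS.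
have [A [mA A0 fA]] := ae_foralln (fun n => ae_foralln (aef n)).
(* Cutting off on the measurable null set [A] preserves measurability and makes the estimates hold
   at every point. *)
pose h n x := (\1_(~` A) x)%:C * f n x.
have hA x n : ~ A x -> h n x = f n x.
  by move=> nAx; rewrite /h indicE mem_set// mul1r.
have hh x n m : (n <= m)%N -> normc (h n x - h m x) <= 2^-1 ^+ n.
  move=> nm; have [Ax|nAx] := pselect (A x).
    rewrite /h indicE memNset; last by move=> /(_ Ax).
    by rewrite !mul0r subrr normc0 ltW// half_expn_gt0.
  rewrite !hA//; move: nm; apply: contrapT => nf.
  by apply: nAx; apply: fA => /= P; exact/nf/P.
have [l hl] := choice (fun x => rapid_complete_complex (hh x)).
(* The constant [C] depends on [x]. Comparing with [h (n + m)] and letting [m] grow replaces it by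
   [1], uniformly in [x]. *)
have {}hl x n : normc (h n x - l x) <= 2^-1 ^+ n.
  have [C hC] := hl x.
  rewrite -subr_le0; apply: (@half_expn_cvg0 _ (C * 2^-1 ^+ n)) => m.
  have := le_normcD (h n x - h (n + m)%N x) (h (n + m)%N x - l x).
  rewrite subrKA => /le_trans; rewrite lerBlDr -mulrA -exprD addrC.
  by apply; rewrite lerD ?hC// hh// leq_addr.
have cvgP (u : nat -> R) (a : R) : (forall n, `|u n - a| <= 2^-1 ^+ n) ->
    u @ \oo --> a.
  move=> ua; apply/cvgrPdist_lt => e e0.
  have [n hn] := half_expn_lt e0; exists n => // m /= nm.
  rewrite distrC (le_lt_trans (ua m))// (le_lt_trans _ hn)//.
  by rewrite ler_wiXn2l ?invf_le1 ?invr_ge0 ?ler1n.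
have mf n : cLinf_val (f n) \in cLinf_fun mu by exact: valP.
have part_measurable (p : R[i] -> R) :
    (forall z, `|p z| <= normc z) -> {morph p : z w / z - w} ->
    (forall (k : R) z, p (k%:C * z) = k * p z) ->
    (forall n, measurable_fun setT (p \o f n)) -> measurable_fun setT (p \o l).
  move=> p_le pB pZ mp.
  apply: (@measurable_fun_cvg _ _ _ _ (fun n x => p (h n x))) => [n|x _].
    rewrite [X in measurable_fun _ X](_ : _ = fun x => \1_(~` A) x * p (f n x)).
      apply: measurable_funM; last exact: mp.
      by apply: measurable_indic; exact: measurableC.
    by apply/funext => x; rewrite /h pZ.
  by apply: cvgP => n; apply: le_trans (hl x n); rewrite /= -pB.
have lP : l \in cLinf_fun mu.
  apply/cLinf_funP; split.
  - apply: (part_measurable (@complex.Re R)) => [|||n].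
    + exact: normc_Re.
    + exact: raddfB.
    + by move=> k [a b] /=; ring.
    + by have /cLinf_funP[] := mf n.
  - apply: (part_measurable (@complex.Im R)) => [|||n].
    + exact: normc_Im.
    + exact: raddfB.
    + by move=> k [a b] /=; ring.
    + by have /cLinf_funP[] := mf n.
  (* The [1] is the distance [2^-0] from [l] to the first term. *)
  - exists (1 + cLinf_norm (f 0%N)).
    have aeA : \forall x \ae mu, ~ A x by exists A; split=> // x /contrapT.
    apply: filterS2 aeA (cLinf_norm_ae (f 0%N)) => x nAx f0.
    have -> : l x = - (h 0%N x - l x) + h 0%N x by ring.
    rewrite (le_trans (le_normcD _ _))// normcN lerD ?hA//.
    by rewrite -hA// (le_trans (hl x 0%N)).
exists (CLinf lP), 1 => n; apply/cLinf_normP.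
  by rewrite mul1r ltW// half_expn_gt0.
have aeA : \forall x \ae mu, ~ A x by exists A; split=> // x /contrapT.
apply: filterS aeA => x nAx; rewrite mul1r (le_trans _ (hl x n))//.
by rewrite hA.
Qed.

Lemma rnorm_cLinfty_pi (f : cLinf mu) : rnorm (\pi_(cLinfty mu) f)%qT = cLinf_norm f.
Proof. by rewrite /rnorm [`|_|]cLinfty_norm_pi. Qed.

Lemma cLinfty_piB (f g : cLinf mu) :
  (\pi_(cLinfty mu) (f - g) = \pi_(cLinfty mu) f - \pi_(cLinfty mu) g)%qT.
Proof.
by rewrite -[RHS]/(cLinfty_add _ (cLinfty_opp _)) cLinfty_piN cLinfty_piD.
Qed.

Lemma cLinfty_rapid_complete : rapid_complete (@rnorm R (cLinfty mu)).
Proof.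
move=> u hu; have hr (v : cLinfty mu) : v = (\pi_(cLinfty mu) (repr v))%qT.
  by rewrite reprK.
have [|l [C hl]] := cLinf_rapid_complete (u := fun n => repr (u n)).
  by move=> n m nm; rewrite -rnorm_cLinfty_pi cLinfty_piB !reprK hu.
exists (\pi_(cLinfty mu) l)%qT, C => n.
by rewrite (hr (u n)) -cLinfty_piB rnorm_cLinfty_pi hl.
Qed.

End LinftyComplete.

(** * The plane F *)

Section Plane.
Context (R : realType).

Definition plane : Type := (R[i] * R[i])%type.
HB.instance Definition _ := GRing.Lmodule.copy plane (R[i]^o * R[i]^o)%type.

(* The unit ball is the convex hull of the discs (a, 0) and (0, b) and the
   torus (a, b/2), |a|, |b| <= 1. *)
Definition plane_rnorm (y : plane) : R :=
  Num.max (normc y.1) (normc y.2 + normc y.1 / 2).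

Lemma le_plane_rnorm1 y : normc y.1 <= plane_rnorm y.
Proof. by rewrite le_max lexx. Qed.

Lemma le_plane_rnorm y : normc y.2 + normc y.1 / 2 <= plane_rnorm y.
Proof. by rewrite le_max lexx orbT. Qed.

Lemma le_plane_rnorm2 y : normc y.2 <= plane_rnorm y.
Proof.
by apply: le_trans (le_plane_rnorm y); rewrite lerDl divr_ge0 ?normc_ge0.
Qed.

Definition plane_norm (y : plane) : R[i] := (plane_rnorm y)%:C.

Lemma plane_normD x y : plane_norm (x + y) <= plane_norm x + plane_norm y.
Proof.
rewrite -rmorphD lecR ge_max.
have h1 : normc (x + y).1 <= normc x.1 + normc y.1 by exact: le_normcD.
have h2 : normc (x + y).2 <= normc x.2 + normc y.2 by exact: le_normcD.
have := le_plane_rnorm1 x; have := le_plane_rnorm1 y.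
have := le_plane_rnorm x; have := le_plane_rnorm y.
by move=> *; apply/andP; split; lra.
Qed.

Lemma plane_normZ (a : R[i]) x : plane_norm (a *: x) = `|a| * plane_norm x.
Proof.
rewrite [`|a|](_ : _ = (normc a)%:C)// -rmorphM; congr (_%:C).
rewrite /plane_rnorm maxr_pMr ?normc_ge0// mulrDr mulrA.
by rewrite -!normcM.
Qed.

Lemma plane_norm0_eq0 x : plane_norm x = 0 -> x = 0.
Proof.
case=> x0; have := le_plane_rnorm1 x; have := le_plane_rnorm2 x.
rewrite x0; case: x x0 => a b _ /= b0 a0.
have n0 (z : R[i]) : normc z <= 0 -> z = 0.
  by move=> z0; apply: eq0_normc; apply/eqP; rewrite eq_le z0 normc_ge0.
by rewrite (n0 a a0) (n0 b b0).
Qed.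

HB.instance Definition _ := Lmodule_isNormed.Build R[i] plane
  plane_normD plane_normZ plane_norm0_eq0.

Lemma plane_rapid_complete : rapid_complete (@rnorm R plane).
Proof.
apply: (@rapid_complete_prod _ _ _ _ (@normc R) (@normc R) _
  (fun y : plane => y.1) (fun y : plane => y.2) (@pair _ _) 2) => //.
- exact: le_plane_rnorm1.
- exact: le_plane_rnorm2.
- move=> y; have := normc_ge0 y.1; have := normc_ge0 y.2 => *.
  by rewrite /rnorm [`|_|]/(plane_norm y)/= ge_max; apply/andP; split; lra.
- exact: rapid_complete_complex.
- exact: rapid_complete_complex.
Qed.

HB.instance Definition _ :=
  Uniform_isComplete.Build plane (rapid_complete_cvg plane_rapid_complete).

Lemma plane_dim2 : Vector.axiom 2 plane.
Proof.
exists (fun y : plane => \row_(k < 2) (if k == 0 then y.1 else y.2)).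
  by move=> a x y; apply/rowP => k; rewrite !mxE; case: ifP.
exists (fun v : 'rV[R[i]]_2 => (v ord0 ord0, v ord0 (lift ord0 ord0))).
  by case=> a b; rewrite !mxE.
by move=> v; apply/rowP => k; rewrite !mxE; case: (unliftP ord0 k) => [j|] ->//;
  rewrite (ord1 j).
Qed.

End Plane.

(** * The mean on Linfty *)

Section Mean.
Context d (T : measurableType d) (R : realType).
Variable mu : {measure set T -> \bar R}.
Hypothesis mu1 : mu setT = 1%E.

Local Notation Linf := (cLinfty mu).
Local Notation cls := (\pi_(cLinfty mu))%qT.

Lemma ae_le_integral_abs (h : T -> R) (M : R) : 0 <= M ->
  measurable_fun setT h -> (\forall x \ae mu, `|h x| <= M) ->
  (\int[mu]_x `|(h x)%:E| <= M%:E)%E.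
Proof.
move=> M0 mh hM; rewrite -[leRHS]mule1 -mu1.
apply: integral_le_bound => //; first exact/measurable_EFinP.
by apply: filterS hM => x hx _; rewrite lee_fin.
Qed.

Lemma ae_bounded_integrable (h : T -> R) (M : R) : 0 <= M ->
  measurable_fun setT h -> (\forall x \ae mu, `|h x| <= M) ->
  mu.-integrable setT (EFin \o h).
Proof.
move=> M0 mh hM; apply/integrableP; split; first exact/measurable_EFinP.
by apply: le_lt_trans (ae_le_integral_abs M0 mh hM) _; rewrite ltry.
Qed.

Lemma cLinf_Re_le (f : cLinf mu) :
  \forall x \ae mu, `|complex.Re (f x)| <= cLinf_norm f.
Proof. by apply: filterS (cLinf_norm_ae f) => x; exact/le_trans/normc_Re. Qed.

Lemma cLinf_Im_le (f : cLinf mu) :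
  \forall x \ae mu, `|complex.Im (f x)| <= cLinf_norm f.
Proof. by apply: filterS (cLinf_norm_ae f) => x; exact/le_trans/normc_Im. Qed.

Lemma cLinf_Re_integrable (f : cLinf mu) :
  mu.-integrable setT (EFin \o (fun x => complex.Re (f x))).
Proof.
have /cLinf_funP[mr _ _] := valP f.
exact: ae_bounded_integrable (cLinf_norm_ge0 f) mr (cLinf_Re_le f).
Qed.

Lemma cLinf_Im_integrable (f : cLinf mu) :
  mu.-integrable setT (EFin \o (fun x => complex.Im (f x))).
Proof.
have /cLinf_funP[_ mi _] := valP f.
exact: ae_bounded_integrable (cLinf_norm_ge0 f) mi (cLinf_Im_le f).
Qed.

(** The complex integral, assembled from its real and imaginary parts; [mean_pi] shows that it is
    independent of the representative. *)
Definition mean (u : Linf) : R[i] :=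
  Complex (\int[mu]_x complex.Re (repr u x)) (\int[mu]_x complex.Im (repr u x)).

Lemma mean_pi (f : cLinf mu) :
  mean (cls f) =
  Complex (\int[mu]_x complex.Re (f x)) (\int[mu]_x complex.Im (f x)).
Proof.
have /cLinf_funP[gr gi _] := valP (repr (cls f)).
have /cLinf_funP[fr fi _] := valP f.
rewrite /mean; congr Complex; congr fine; apply: ae_eq_integral => //;
  (try exact/measurable_EFinP);
  by apply: filterS (cLinfty_reprP f) => x /= ->.
Qed.

Lemma meanP (a : R[i]) u v : mean (a *: u + v) = a * mean u + mean v.
Proof.
have [f ->] := cLinfty_piP u; have [g ->] := cLinfty_piP v.
have -> : a *: cls f + cls g = cls (a *: f + g).
  by rewrite -cLinfty_piD -cLinfty_piZ.
have If := cLinf_Re_integrable f; have Jf := cLinf_Im_integrable f.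
have Ig := cLinf_Re_integrable g; have Jg := cLinf_Im_integrable g.
have IZ (h : T -> R) k : mu.-integrable setT (EFin \o h) ->
    mu.-integrable setT (EFin \o (fun x => k * h x)).
  by move=> ih; apply: eq_integrable (integrableZl _ k ih).
have ID (h k : T -> R) : mu.-integrable setT (EFin \o h) ->
    mu.-integrable setT (EFin \o k) ->
    mu.-integrable setT (EFin \o (fun x => h x + k x)).
  by move=> ih ik; apply: eq_integrable (integrableD _ ih ik).
rewrite !mean_pi; case: a => a b; congr Complex.
  rewrite (_ : (fun x => _) = fun x => (a * complex.Re (f x) +
    (- b) * complex.Im (f x)) + complex.Re (g x)); last first.
    apply/funext => x; rewrite -[_ x]/(Complex a b * f x + g x).
    by case: (f x) (g x) => ? ? [? ?] /=; ring.
  rewrite !RintegralD ?RintegralZl//; [ring|exact: IZ|exact: IZ|].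
  by apply: ID; exact: IZ.
rewrite (_ : (fun x => _) = fun x => (a * complex.Im (f x) +
  b * complex.Re (f x)) + complex.Im (g x)); last first.
  apply/funext => x; rewrite -[_ x]/(Complex a b * f x + g x).
  by case: (f x) (g x) => ? ? [? ?] /=; ring.
rewrite !RintegralD ?RintegralZl//; [exact: IZ|exact: IZ|].
by apply: ID; exact: IZ.
Qed.

Lemma mean0 : mean 0 = 0.
Proof.
by have := meanP (-1) 0 0; rewrite scaler0 addr0 mulN1r addNr.
Qed.

Lemma meanZ (a : R[i]) u : mean (a *: u) = a * mean u.
Proof. by rewrite -[a *: u]addr0 meanP mean0 addr0. Qed.

Lemma Re_mean_le u : complex.Re (mean u) <= rnorm u.
Proof.
have [f ->] := cLinfty_piP u; rewrite mean_pi rnorm_cLinfty_pi /=.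
apply: le_trans (ler_norm _) _; rewrite -lee_fin EFin_normr_Rintegral//; last first.
  exact: cLinf_Re_integrable.
have /cLinf_funP[mr _ _] := valP f.
apply: le_trans (ae_le_integral_abs (cLinf_norm_ge0 f) mr (cLinf_Re_le f)).
by apply: le_abse_integral => //; exact/measurable_EFinP.
Qed.

(** Rotating [u] makes its mean equal to the modulus, so the bound on real parts suffices and no
    constant is lost. *)
Lemma normc_mean_le u : normc (mean u) <= rnorm u.
Proof.
have [e e1 ue] := complex_polar (mean u).
have e0 : e != 0 by apply: contra_eq_neq e1 => ->; rewrite normc0 eq_sym oner_eq0.
have := Re_mean_le (e^-1 *: u).
by rewrite meanZ {1}ue mulrCA mulVf// mulr1 rnormZ normcV e1 invr1 mul1r.
Qed.

Lemma cLinf_one_subproof : (fun _ : T => 1 : R[i]) \in cLinf_fun mu.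
Proof.
by apply/cLinf_funP; split; [exact: measurable_cst..|
  exists (normc (1 : R[i])); exact: aeW].
Qed.

Definition Linfty_one : Linf := cls (CLinf cLinf_one_subproof).

Lemma mean_one : mean Linfty_one = 1.
Proof.
by rewrite mean_pi /= !Rintegral_cst// mu1 /= mulr1 mul0r.
Qed.

End Mean.

(** * The projective tensor product *)

Section TensorWithPlane.
Context d (T : measurableType d) (R : realType).
Variable mu : {measure set T -> \bar R}.

Local Notation Linf := (cLinfty mu).
Local Notation cls := (\pi_(cLinfty mu))%qT.

(** A pair [(u, v)] stands for the sum of [u] tensor [(1, 0)] and [v] tensor [(0, 1)]. Only the
    module structure is copied, as the norm is to be the projective one. *)
Definition Linfty_plane : Type := (Linf * Linf)%type.
HB.instance Definition _ := GRing.Lmodule.copy Linfty_plane (Linf * Linf)%type.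

Definition tensor_plane (g : Linf) (y : plane R) : Linfty_plane :=
  (y.1 *: g, y.2 *: g).

Lemma tensor_plane_bilinear : bilinear_for *:%R *:%R tensor_plane.
Proof.
split=> [y|g] a u v.
  by congr pair => /=; rewrite scalerDr !scalerA mulrC.
by congr pair; rewrite scalerDl -scalerA.
Qed.

HB.instance Definition _ := bilinear_isBilinear.Build R[i] Linf (plane R)
  Linfty_plane *:%R *:%R tensor_plane tensor_plane_bilinear.

Local Notation t := (tensor_plane : {bilinear Linf -> plane R -> Linfty_plane}).

Lemma tensor_planeE (u : Linfty_plane) :
  u = tensor_plane u.1 (1, 0) + tensor_plane u.2 (0, 1).
Proof.
case: u => u v; congr pair => /=.
  by rewrite scale1r scale0r addr0.
by rewrite scale1r scale0r add0r.
Qed.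

(** The factorization is forced by its values on tensors with the two basis vectors of the plane. *)
Lemma algebraic_tensor_plane : algebraic_tensor t.
Proof.
move=> V f.
pose g (u : Linfty_plane) : V := f u.1 (1, 0) + f u.2 (0, 1).
have g_lin : linear g.
  move=> a u v; rewrite /g.
  rewrite !(linearDl f, linearZl_LR f) /=.
  by rewrite addrACA scalerDr.
pose gL := GRing.isLinear.Build _ _ _ _ g g_lin.
pose g' : {linear Linfty_plane -> V} := HB.pack g gL.
exists g'; split.
  move=> x [a b]; rewrite /= /g /=.
  rewrite !linearZl_LR -!linearZr_LR -linearDr; congr (f x _).
  by congr pair => /=; rewrite /GRing.scale/= !(mulr1, mulr0, addr0, add0r).
move=> h hE; apply/linear_ext => u /=.
by rewrite /g [in RHS](tensor_planeE u) linearD !hE.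
Qed.

Lemma tensor_plane_span (u : Linfty_plane) :
  exists s : seq (Linf * plane R), u = \sum_(p <- s) t p.1 p.2.
Proof.
exists [:: (u.1, (1, 0)); (u.2, (0, 1))].
by rewrite big_cons big_seq1 -tensor_planeE.
Qed.

Lemma rnorm_fst_le_pi_norm (u : Linfty_plane) : rnorm u.1 <= pi_norm t u.
Proof.
rewrite -[leRHS]mul1r; apply: (@le_pi_norm R _ _ _ t tensor_plane_span
  (fun u => rnorm u.1)) => //.
- by rewrite rnorm0.
- by move=> v w; exact: rnormD.
- move=> x y; rewrite rnormZ mul1r mulrC ler_wpM2l ?rnorm_ge0//.
  exact: le_plane_rnorm1.
Qed.

Lemma rnorm_snd_le_pi_norm (u : Linfty_plane) : rnorm u.2 <= pi_norm t u.
Proof.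
rewrite -[leRHS]mul1r; apply: (@le_pi_norm R _ _ _ t tensor_plane_span
  (fun u => rnorm u.2)) => //.
- by rewrite rnorm0.
- by move=> v w; exact: rnormD.
- move=> x y; rewrite rnormZ mul1r mulrC ler_wpM2l ?rnorm_ge0//.
  exact: le_plane_rnorm2.
Qed.

Lemma rnorm_plane_fst a : rnorm ((a, 0) : plane R) = normc a.
Proof.
rewrite [LHS]/(Num.max (normc a) (normc 0 + normc a / 2)) normc0 add0r.
apply/max_idPl.
by have := normc_ge0 a; lra.
Qed.

Lemma rnorm_plane_snd a : rnorm ((0, a) : plane R) = normc a.
Proof.
rewrite [LHS]/(Num.max (normc 0) (normc a + normc 0 / 2)) normc0 mul0r addr0.
apply/max_idPr.
exact: normc_ge0.
Qed.

(** With the two coordinate bounds above, this makes the projective norm equivalent to the sum of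
    the coordinate norms, whence completeness. *)
Lemma pi_norm_le (u : Linfty_plane) :
  pi_norm t u <= rnorm u.1 + rnorm u.2.
Proof.
rewrite [in leLHS](tensor_planeE u) (le_trans (pi_normD tensor_plane_span _ _))//.
have n1 : normc (1 : R[i]) = 1 by exact: (normc_real ler01).
rewrite lerD// (le_trans (pi_norm_tensor t _ _))//.
  by rewrite rnorm_plane_fst n1 mulr1.
by rewrite rnorm_plane_snd n1 mulr1.
Qed.

Definition Linfty_plane_norm (u : Linfty_plane) : R[i] := (pi_norm t u)%:C.

Lemma Linfty_plane_normD u v :
  Linfty_plane_norm (u + v) <= Linfty_plane_norm u + Linfty_plane_norm v.
Proof. by rewrite -rmorphD lecR; exact: pi_normD tensor_plane_span _ _. Qed.

Lemma Linfty_plane_normZ (a : R[i]) u :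
  Linfty_plane_norm (a *: u) = `|a| * Linfty_plane_norm u.
Proof.
rewrite [`|a|](_ : _ = (normc a)%:C)// -rmorphM; congr (_%:C).
exact: pi_normZ tensor_plane_span _ _.
Qed.

Lemma Linfty_plane_norm0_eq0 u : Linfty_plane_norm u = 0 -> u = 0.
Proof.
case=> u0; have := rnorm_fst_le_pi_norm u; have := rnorm_snd_le_pi_norm u.
rewrite u0; case: u {u0} => u v /= v0 u0.
have n0 (w : Linf) : rnorm w <= 0 -> w = 0.
  by move=> w0; apply: rnorm0_eq0; apply/eqP; rewrite eq_le w0 rnorm_ge0.
by rewrite (n0 u u0) (n0 v v0).
Qed.

HB.instance Definition _ := Lmodule_isNormed.Build R[i] Linfty_plane
  Linfty_plane_normD Linfty_plane_normZ Linfty_plane_norm0_eq0.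

Lemma Linfty_plane_rapid_complete : rapid_complete (@rnorm R Linfty_plane).
Proof.
apply: (@rapid_complete_prod _ _ _ _ (@rnorm R Linf) (@rnorm R Linf) _
  (fun u : Linfty_plane => u.1) (fun u : Linfty_plane => u.2) (@pair _ _) 1) => //.
- exact: rnorm_fst_le_pi_norm.
- exact: rnorm_snd_le_pi_norm.
- by move=> u; rewrite mul1r; exact: pi_norm_le.
- exact: cLinfty_rapid_complete.
- exact: cLinfty_rapid_complete.
Qed.

HB.instance Definition _ := Uniform_isComplete.Build Linfty_plane
  (rapid_complete_cvg Linfty_plane_rapid_complete).

Lemma rnorm_tensor_plane (g : Linf) (y : plane R) :
  rnorm (tensor_plane g y) <= rnorm g * rnorm y.
Proof. exact: pi_norm_tensor t g y. Qed.

Lemma le_rnorm_Linfty_plane (N : Linfty_plane -> R) (K : R) :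
  0 <= K -> N 0 <= 0 ->
  (forall u v, N (u + v) <= N u + N v) ->
  (forall g y, N (tensor_plane g y) <= K * (rnorm g * rnorm y)) ->
  forall u, N u <= K * rnorm u.
Proof. exact: le_pi_norm tensor_plane_span _ _. Qed.

(** The algebraic tensor product is already complete, so the identity serves as the dense isometric
    embedding. *)
Lemma Linfty_plane_projective :
  is_projective_tensor Linf (plane R) Linfty_plane.
Proof.
exists Linfty_plane, t, (idfun : {linear Linfty_plane -> Linfty_plane}).
split=> //; first exact: algebraic_tensor_plane.
by move=> O [u Ou] _; exists u; split=> //; exists u.
Qed.

End TensorWithPlane.

(** * The rank-one operator *)

Section Estimate.
Context d (T : measurableType d) (R : realType).
Variable mu : {measure set T -> \bar R}.
Hypothesis mu1 : mu setT = 1%E.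

Local Notation Linf := (cLinfty mu).
Local Notation cls := (\pi_(cLinfty mu))%qT.
Local Notation Z := (Linfty_plane mu).
Local Notation t := (@tensor_plane _ _ _ mu).
Local Notation one := (Linfty_one mu).

(** Since [h] is real, [r + i s h] has modulus [sqrt (r^2 + s^2 h^2)]: an imaginary perturbation of
    a real constant costs only second order in [s]. *)
Lemma rnorm_scale_one_imaginary (h : T -> R) (u : Linf) (M : R) (r s : R) :
  0 <= M -> (\forall x \ae mu, `|h x| <= M) ->
  (exists2 f, u = cls f & forall x, f x = (h x)%:C) ->
  rnorm (r%:C *: one + Complex 0 s *: u) <= Num.sqrt (r ^+ 2 + (s * M) ^+ 2).
Proof.
move=> M0 hM [f -> fh].
have -> : r%:C *: one + Complex 0 s *: cls f =
    cls (r%:C *: CLinf (cLinf_one_subproof mu) + Complex 0 s *: f).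
  by rewrite -cLinfty_piD -!cLinfty_piZ.
rewrite rnorm_cLinfty_pi; apply/cLinf_normP; first exact: sqrtr_ge0.
apply: filterS hM => x hx.
rewrite [X in normc X](_ : _ = Complex r (s * h x)); last first.
  transitivity (r%:C * 1 + Complex 0 s * f x); first by [].
  by rewrite fh; congr Complex; rewrite /=; ring.
rewrite ler_sqrt ?addr_ge0 ?sqr_ge0// lerD2l !exprMn ler_wpM2l ?sqr_ge0//.
by rewrite -real_normK ?num_real// lerXn2r ?nnegrE.
Qed.

(** [a] and [b] are the real and imaginary parts of [g]. The square-root bounds are all that is
    later used of their being real. *)
Lemma cLinfty_split (g : Linf) : exists a b : Linf,
  [/\ g = a + Complex 0 1 *: b,
      forall r s, rnorm (r%:C *: one + Complex 0 s *: a) <=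
        Num.sqrt (r ^+ 2 + (s * rnorm g) ^+ 2)
    & forall r s, rnorm (r%:C *: one + Complex 0 s *: b) <=
        Num.sqrt (r ^+ 2 + (s * rnorm g) ^+ 2)].
Proof.
have [f ->] := cLinfty_piP g; have [fr fi [M fM]] := (cLinf_funP mu f).1 (valP f).
have real_Linf (h : T -> R) : measurable_fun setT h ->
    (\forall x \ae mu, `|h x| <= M) -> (fun x => (h x)%:C) \in cLinf_fun mu.
  move=> mh hM; apply/cLinf_funP; split=> //; exists M.
  by apply: filterS hM => x; rewrite /= expr0n addr0 sqrtr_sqr.
have aP : (fun x => (complex.Re (f x))%:C) \in cLinf_fun mu.
  by apply: real_Linf => //; apply: filterS fM => x; exact/le_trans/normc_Re.
have bP : (fun x => (complex.Im (f x))%:C) \in cLinf_fun mu.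
  by apply: real_Linf => //; apply: filterS fM => x; exact/le_trans/normc_Im.
exists (cls (CLinf aP)), (cls (CLinf bP)); rewrite rnorm_cLinfty_pi; split.
- rewrite -[RHS]/(cLinfty_add _ (cLinfty_scale _ _)) cLinfty_piZ cLinfty_piD.
  congr (cls _); apply: val_inj; apply/funext => x.
  transitivity ((complex.Re (f x))%:C + Complex 0 1 * (complex.Im (f x))%:C).
    by rewrite /=; case: (f x) => a b; congr Complex; rewrite /=; ring.
  by [].
- move=> r s; apply: (@rnorm_scale_one_imaginary (fun x => complex.Re (f x))).
  + exact: cLinf_norm_ge0.
  + exact: cLinf_Re_le.
  + by exists (CLinf aP).
- move=> r s; apply: (@rnorm_scale_one_imaginary (fun x => complex.Im (f x))).
  + exact: cLinf_norm_ge0.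
  + exact: cLinf_Im_le.
  + by exists (CLinf bP).
Qed.

(* Writing g = a + i b with a, b real, (r, g) is the sum of
   (r +- i b/4)/4 (x) (1, +-1/2), (r -+ i a/4)/4 (x) (1, +-i/2) and
   (15/16) g (x) (0, 1). *)
Lemma rnorm_one_pair (r : R) (g : Linf) : 0 <= r -> r <= rnorm g ->
  rnorm ((r%:C *: one, g) : Z) <= 63 / 32 * rnorm g.
Proof.
move=> r0 rg; have [a [b [gab ha hb]]] := cLinfty_split g.
pose A := (r / 4)%:C *: one.
pose B := Complex 0 (1 / 16) *: b.
pose C := Complex 0 (1 / 16) *: a.
(* Fixing only [s ^+ 2] covers both signs. As [r <= rnorm g], the constant must dominate
   [sqrt (1/16 + 1/256) = sqrt 17 / 16], and [33/128] does because [17 * 64 = 1088 <= 33^2]. *)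
have normG (u v : Linf) (s : R) (x : R[i]) :
    (forall r s, rnorm (r%:C *: one + Complex 0 s *: u) <=
        Num.sqrt (r ^+ 2 + (s * rnorm g) ^+ 2)) ->
    s ^+ 2 = (1 / 16) ^+ 2 -> normc x = 1 / 2 ->
    rnorm (t (A + Complex 0 s *: u) (1, x)) <= 33 / 128 * rnorm g.
  move=> hu s2 x2; apply: le_trans (rnorm_tensor_plane _ _) _.
  have -> : rnorm ((1, x) : plane R) = 1.
    rewrite [LHS]/(Num.max (normc 1) (normc x + normc 1 / 2)) x2.
    have -> : normc (1 : R[i]) = 1 by exact: (normc_real ler01).
    by apply/max_idPl; lra.
  rewrite mulr1 (le_trans (hu _ _))//.
  have g33 : 0 <= 33 / 128 * rnorm g by rewrite mulr_ge0 ?rnorm_ge0//; lra.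
  rewrite -[leRHS](ger0_norm g33) -sqrtr_sqr ler_sqrt ?sqr_ge0//.
  rewrite [(s * _) ^+ 2]exprMn s2; have := lerXn2r 2 r0 (rnorm_ge0 g) rg.
  by nra.
have -> : (r%:C *: one, g) = t (A + B) (1, (1 / 2)%:C)
    + t (A - B) (1, (- (1 / 2))%:C) + t (A - C) (1, Complex 0 (1 / 2))
    + t (A + C) (1, Complex 0 (- (1 / 2))) + t g (0, (15 / 16)%:C) :> Z.
  (* Within a pair of opposite vectors the constants cancel in the second coordinate and the
     perturbations add up. *)
  have D (x : R[i]) (v w : Linf) : x *: (v + w) - x *: (v - w) = (x + x) *: w.
    by rewrite -scalerBr opprB addrC addrA subrK scalerDr scalerDl.
  have E1 : r%:C *: one = (A + B) + (A - B) + (A - C) + (A + C).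
    rewrite -[RHS]addrA [X in X + _]addrACA.
    rewrite [X in _ + X]addrACA subrr addNr !addr0 /A -!scalerDl.
    by congr (_ *: _); rewrite -!rmorphD; congr (_%:C); field.
  have E2 : g = (1 / 2)%:C *: (A + B) - (1 / 2)%:C *: (A - B)
      + Complex 0 (1 / 2) *: (A - C) - Complex 0 (1 / 2) *: (A + C)
      + (15 / 16)%:C *: g.
    (* This puts the second pair in the form of [D], with [w = - C]. *)
    have -> : A + C = A - - C by rewrite opprK.
    rewrite D -[_ + _ - _]addrA D scalerN /B /C !scalerA -scaleNr.
    rewrite [in RHS]gab scalerDr scalerA [X in X + _]addrC addrACA -!scalerDl gab.
    congr (_ + _ *: _); last by congr Complex; rewrite /=; field.
    rewrite -[LHS]scale1r; congr (_ *: _).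
    by congr Complex; rewrite /=; field.
  congr pair; rewrite [RHS]/=.
    by rewrite !scale1r scale0r addr0.
  have NE (k : R) : (- k)%:C = - k%:C by rewrite rmorphN.
  have NI (k : R) : Complex 0 (- k) = - Complex 0 k by congr Complex; ring.
  by rewrite NE NI !scaleNr.
(* Four terms of [33/128] and the remainder [15/16] add up to [63/32], which is below [2]. *)
have -> : 63 / 32 * rnorm g = 33 / 128 * rnorm g + 33 / 128 * rnorm g
    + 33 / 128 * rnorm g + 33 / 128 * rnorm g + 15 / 16 * rnorm g by field.
have norm_y (s : R) : s ^+ 2 = (1 / 2) ^+ 2 -> normc (Complex 0 s) = 1 / 2.
  by move=> s2; rewrite /= expr0n add0r s2 sqrtr_sqr ger0_norm//; lra.
have norm_x (s : R) : s ^+ 2 = (1 / 2) ^+ 2 -> normc s%:C = 1 / 2.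
  by move=> s2; rewrite /= expr0n addr0 s2 sqrtr_sqr ger0_norm//; lra.
have NI (k : R) : - Complex 0 k = Complex 0 (- k) by congr Complex; ring.
apply: le_trans (rnormD _ _) (lerD _ _); last first.
  apply: le_trans (rnorm_tensor_plane _ _) _; rewrite rnorm_plane_snd normc_real; last lra.
  by rewrite [leRHS]mulrC.
apply: le_trans (rnormD _ _) (lerD _ _); last first.
  by apply: normG => //; rewrite ?norm_y// sqrrN.
apply: le_trans (rnormD _ _) (lerD _ _); last first.
  by rewrite /C -scaleNr NI; apply: normG => //; rewrite ?norm_y// sqrrN.
apply: le_trans (rnormD _ _) (lerD _ _).
  by apply: normG => //; exact: norm_x.
by rewrite /B -scaleNr NI; apply: normG => //; rewrite ?norm_x// sqrrN.
Qed.

Definition mean_op (u : Z) : Z := (mean u.2 *: one, 0).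

Lemma mean_op_is_linear : linear mean_op.
Proof.
move=> a u v; congr pair => /=; last by rewrite scaler0 addr0.
by rewrite (meanP mu1) scalerDl scalerA.
Qed.

HB.instance Definition _ :=
  GRing.isLinear.Build R[i] Z Z *:%R mean_op mean_op_is_linear.

Lemma mean_op_rank1 : rank1 mean_op.
Proof.
have one0 : one != 0.
  by apply/eqP => /(congr1 (@mean _ _ _ mu))/eqP; rewrite mean_one// mean0// oner_eq0.
exists ((one, 0) : Z); first by apply: contra_neq one0 => -[].
apply/seteqP; split=> _ [u _ <-].
  by exists (mean u.2) => //; rewrite /mean_op; congr pair; rewrite scaler0.
exists (0, u *: one) => //; rewrite /mean_op /= meanZ// mean_one// mulr1.
by congr pair; rewrite scaler0.
Qed.

(** Multiplying by a unit scalar turns the mean into its modulus and leaves both norms unchanged,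
    which reduces to [rnorm_one_pair]. *)
Lemma rnorm_mean_pair (g : Linf) :
  rnorm ((mean g *: one, g) : Z) <= 63 / 32 * rnorm g.
Proof.
have [e e1 ge] := complex_polar (mean g).
have e0 : e != 0 by apply: contra_eq_neq e1 => ->; rewrite normc0 eq_sym oner_eq0.
have -> : (mean g *: one, g) = e *: ((normc (mean g))%:C *: one, e^-1 *: g) :> Z.
  by congr pair => /=; rewrite scalerA ?divff ?scale1r// mulrC -ge.
rewrite rnormZ e1 mul1r.
have eg : rnorm (e^-1 *: g) = rnorm g by rewrite rnormZ normcV e1 invr1 mul1r.
rewrite -eg; apply: rnorm_one_pair; first exact: normc_ge0.
by rewrite eg; exact: normc_mean_le.
Qed.

(** It suffices to test elementary tensors. The image of [t g y] splits into [t g (y.1, 0)] and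
    [y.2] times the pair just estimated. *)
Lemma rnorm_id_mean_op (u : Z) : rnorm (u + mean_op u) <= 127 / 64 * rnorm u.
Proof.
apply: (@le_rnorm_Linfty_plane _ _ _ _ (fun u => rnorm (u + mean_op u))).
- by lra.
- by rewrite linear0 addr0 rnorm0.
- by move=> v w; rewrite linearD addrACA; exact: rnormD.
move=> g y.
have -> : t g y + mean_op (t g y) = t g (y.1, 0) + y.2 *: (mean g *: one, g) :> Z.
  congr pair => /=; first by rewrite meanZ// scalerA.
  by rewrite scale0r add0r addr0.
have h1 := rnorm_tensor_plane g (y.1, 0).
have h2 := rnorm_mean_pair g.
apply: le_trans (rnormD _ _) _; rewrite rnormZ.
rewrite rnorm_plane_fst in h1.
have y1 := le_plane_rnorm1 y; have y2 := le_plane_rnorm y.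
rewrite -[plane_rnorm y]/(rnorm y) in y1 y2.
have hb := ler_wpM2l (normc_ge0 y.2) h2.
apply: le_trans (lerD h1 hb) _.
(* Add [1/64] times [y1] and [63/32] times [y2]: the coefficient of [normc y.1] is [1/64 + 63/64],
   and the weights sum to [127/64]. *)
have y12 : normc y.1 + 63 / 32 * normc y.2 <= 127 / 64 * rnorm y by lra.
have := ler_wpM2l (rnorm_ge0 g) y12; lra.
Qed.

Lemma rnorm_one_le1 : rnorm one <= 1.
Proof.
rewrite rnorm_cLinfty_pi; apply/cLinf_normP => //; apply: aeW => x /=.
by rewrite expr0n addr0 expr1n sqrtr1.
Qed.

(** The value is the elementary tensor of the constant [1] with [(mean u.2, 0)], and every map
    involved is a contraction. *)
Lemma rnorm_mean_op (u : Z) : rnorm (mean_op u) <= rnorm u.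
Proof.
have -> : mean_op u = t one (mean u.2, 0).
  by congr pair => /=; rewrite scale0r.
rewrite (le_trans (rnorm_tensor_plane _ _))// rnorm_plane_fst.
apply: le_trans (rnorm_snd_le_pi_norm u).
by rewrite (le_trans _ (normc_mean_le mu1 _))// ler_piMl ?normc_ge0 ?rnorm_one_le1.
Qed.

Lemma not_Daugavet_Linfty_plane : ~ Daugavet Z.
Proof.
move=> D.
have bounded : bounded_operator mean_op.
  by exists 1 => u; rewrite mul1r rnorm_mean_op.
have := D mean_op bounded mean_op_rank1.
have id_le : opnorm (fun u : Z => u + mean_op u) <= 127 / 64.
  apply: ge_sup.
    by exists (rnorm ((0 : Z) + mean_op 0)), 0 => //=; rewrite rnorm0.
  move=> _ [u /= u1 <-]; apply: le_trans (rnorm_id_mean_op u) _; lra.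
(* Tested on [t one (0, 1)]: the image has first coordinate [one], whose norm is at least its mean
   [1]. *)
have op_ge : 1 <= opnorm mean_op.
  apply: (@le_trans _ _ (rnorm (mean_op (t one (0, 1))))).
    apply: le_trans (rnorm_fst_le_pi_norm _); rewrite /mean_op /= scale1r.
    rewrite mean_one// scale1r; apply: le_trans (normc_mean_le mu1 _).
    by rewrite mean_one// (normc_real ler01).
  apply: ub_le_sup.
    by exists 1 => _ [u /= u1 <-]; exact: le_trans (rnorm_mean_op u) _.
  exists (t one (0, 1)) => //=; apply: le_trans (rnorm_tensor_plane _ _) _.
  by rewrite rnorm_plane_snd (normc_real ler01) mulr1 rnorm_one_le1.
(* The Daugavet equation would give [2 <= 127/64]. *)
lra.
Qed.

End Estimate.

Theorem corollary4p3 (R : realType) :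
  exists F : completeNormedModType R[i],
    inhabited (Vector.axiom 2 F) /\
    exists Z : completeNormedModType R[i],
      is_projective_tensor (Linfty01 R) F Z /\ ~ Daugavet Z.
Proof.
exists (plane R); split; first by constructor; exact: plane_dim2.
exists (Linfty_plane (lebesgue01 R)); split.
  exact: Linfty_plane_projective.
apply: not_Daugavet_Linfty_plane.
(* What remains is the normalization: the restricted measure of the whole line is the length of
   [[0, 1]]. *)
rewrite [LHS]/(lebesgue_measure (setT `&` [set` `[0 : R, 1 : R]])).
by rewrite setTI; apply: etrans (lebesgue_measure_itv _) _; rewrite /= lte01 sube0.
Qed.
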